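(* Let $\alpha_0,\alpha_1,\alpha_2$ be complex parameters. Consider a polynomial Hamiltonian system $$\frac{dx}{dt}=\frac{\partial K}{\partial y},\quad \frac{dy}{dt}=-\frac{\partial K}{\partial x},\quad \frac{dz}{dt}=\frac{\partial K}{\partial w},\quad \frac{dw}{dt}=-\frac{\partial K}{\partial z}$$ with Hamiltonian $K\in\mathbb{C}(t)[x,y,z,w]$. Assume that (A1) $\deg(K)=6$ with respect to $x,y,z,w$. (A2) This system becomes again a polynomial Hamiltonian system in each coordinate system $r_i$ $(i=0,1,2)$: $$r_0:\ x_0=x,\ y_0=y,\ z_0=\frac1z,\ w_0=-(wz+\alpha_0)z,$$ $$r_1:\ x_1=-((x+z^2)y-\alpha_1)y,\ y_1=\frac1y,\ z_1=z,\ w_1=w-2yz,$$ $$r_2:\ x_2=-((x+y^2+w+t)y-\alpha_2)y,\ y_2=\frac1y,\ z_2=z+y,\ w_2=w.$$ Then such a system coincides with the Hamiltonian system $$\frac{dx}{dt}=\frac{\partial H}{\partial y},\quad \frac{dy}{dt}=-\frac{\partial H}{\partial x},\quad \frac{dz}{dt}=\frac{\partial H}{\partial w},\quad \frac{dw}{dt}=-\frac{\partial H}{\partial z}$$ with the polynomial Hamiltonian $$H=2xy^2+2x^2+2tx-2\alpha_1 y+z^2w-\frac{w^2}{2}+\alpha_0 z+xw+2yzw.$$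
   Context: Condition (A2) is to be read as: $r_0(K)$, $r_1(K)$ and $r_2(K+y)$ are polynomials with respect to $x_i,y_i,z_i,w_i$ (for $i=0,1,2$ respectively), where $r_i(G)$ denotes $G$ expressed in the coordinates $x_i,y_i,z_i,w_i$ by means of the birational change of coordinates $r_i$. The Hamiltonian system with Hamiltonian $H$ is the one whose parameters satisfy $\alpha_0+2\alpha_1+2\alpha_2=1$; this relation is not a hypothesis of the theorem, but is said to be recovered by it. *)

(* Defs.v *)
From HB Require Import structures.
From mathcomp Require Import all_boot all_order all_algebra fraction.
From mathcomp Require Import reals.
From mathcomp Require Import complex mpoly.

Set Implicit Arguments.
Unset Strict Implicit.
Unset Printing Implicit Defensive.

Import GRing.Theory.
Local Open Scope ring_scope.

(* C(t), for C = R[i]; t is an indeterminate. *)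
Definition Ct (R : realType) : fieldType := {fraction {poly R[i]}}.

Definition scal (R : realType) (a : R[i]) : Ct R := tofrac a%:P.
Definition tvar (R : realType) : Ct R := tofrac 'X.

Definition ix : 'I_4 := @Ordinal 4 0 isT.
Definition iy : 'I_4 := @Ordinal 4 1 isT.
Definition iz : 'I_4 := @Ordinal 4 2 isT.
Definition iw : 'I_4 := @Ordinal 4 3 isT.

(* Everything below is over a field F of coefficients, containing t and the
   parameters; it is used with F = C(t). *)
Notation ratfun F := {fraction {mpoly F[4]}}.

Definition coefF (F : fieldType) : F -> ratfun F := @tofrac _ \o @mpolyC 4 F.

Section Coordinates.
Variables (F : fieldType) (t a0 a1 a2 : F).

Let x : ratfun F := tofrac ('X_ix : {mpoly F[4]}).
Let y : ratfun F := tofrac ('X_iy : {mpoly F[4]}).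
Let z : ratfun F := tofrac ('X_iz : {mpoly F[4]}).
Let w : ratfun F := tofrac ('X_iw : {mpoly F[4]}).

(* The new coordinates (x_i, y_i, z_i, w_i), as rational functions of the old
   ones. *)
Definition r0 : 4.-tuple (ratfun F) :=
  [tuple x; y; z^-1; - (w * z + coefF a0) * z].

Definition r1 : 4.-tuple (ratfun F) :=
  [tuple - ((x + z ^+ 2) * y - coefF a1) * y; y^-1; z; w - 2%:R * y * z].

Definition r2 : 4.-tuple (ratfun F) :=
  [tuple - ((x + y ^+ 2 + w + coefF t) * y - coefF a2) * y; y^-1; z + y; w].

End Coordinates.

(* G, expressed in the coordinates r, is a polynomial with coefficients in F:
   G(x,y,z,w) = P(x_i,y_i,z_i,w_i) for some P. As each r_i is birational, such a
   P is the result of substituting the inverse of r_i in G. *)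
Definition polynomial_in (F : fieldType) (r : 4.-tuple (ratfun F))
    (G : {mpoly F[4]}) : Prop :=
  exists P : {mpoly F[4]}, mmap (@coefF F) (tnth r) P = tofrac G.

(* The coordinates r2 depend on t: at fixed x, y, z, w, the time derivative of
   x_2 is - y^2 = - 1 / y_2^2 and that of y_2, z_2, w_2 is 0. Hence K becomes
   the Hamiltonian K + 1 / y_2 = K + y. *)
Definition condA2 (F : fieldType) (t a0 a1 a2 : F) (K : {mpoly F[4]}) : Prop :=
  [/\ polynomial_in (r0 a0) K,
      polynomial_in (r1 a1) K &
      polynomial_in (r2 t a2) (K + 'X_iy)].

(* The right-hand sides of the equations for dx/dt, dy/dt, dz/dt, dw/dt. *)
Definition hamiltonian_system (F : fieldType) (K : {mpoly F[4]}) :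
    4.-tuple {mpoly F[4]} :=
  [tuple K^`M(iy); - K^`M(ix); K^`M(iw); - K^`M(iz)].

Definition HamH (F : fieldType) (t a0 a1 : F) : {mpoly F[4]} :=
  let x : {mpoly F[4]} := 'X_ix in
  let y : {mpoly F[4]} := 'X_iy in
  let z : {mpoly F[4]} := 'X_iz in
  let w : {mpoly F[4]} := 'X_iw in
  2%:R * x * y ^+ 2 + 2%:R * x ^+ 2 + 2%:R * t%:MP * x - 2%:R * a1%:MP * y
  + z ^+ 2 * w - (2%:R^-1 : F) *: w ^+ 2 + a0%:MP * z + x * w
  + 2%:R * y * z * w.

(* Main.v *)
(* Give x, y, z, w the weights 2, 1, 1, 2.  After one of the weight-preserving
   substitutions below, each chart r_i becomes p -> 1/p, q -> -((q + b) p + a) p on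
   a pair of coordinates of weights 1 and 2.  The leading monomials of the products
   of the new coordinates are distinct, so in the leading form of a function
   that is polynomial in the new coordinates only monomials p^k q^l with k <= 2 l
   occur.  These integer linear conditions do not involve the parameters, and in
   degree at most 6 they leave, in positive weight, only multiples of the leading
   forms of H and H^2.

   Put eta = a0 + 2 a1 + 2 a2.  As H is polynomial in r_0 and r_1 and H + eta y in r_2,
   subtracting c1 H + c2 H^2 from K and descending through the weights shows that K
   is c1 H + c2 H^2 up to a constant, with obstruction c2 eta = 0 in weight 5 and
   1 - c1 eta = 0 in weight 1.  Hence eta is nonzero, c2 = 0 and K = H / eta up to a
   constant; in particular no K of degree exactly 6 exists. *)

Require Import Defs.
From Stdlib Require Import ZArith.
From HB Require Import structures.
From mathcomp Require Import all_boot all_order all_algebra fraction.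
From mathcomp Require Import reals.
From mathcomp Require Import complex mpoly.
From mathcomp Require Import ring zify ssrZ.

Set Implicit Arguments.
Unset Strict Implicit.
Unset Printing Implicit Defensive.

Import GRing.Theory.
Local Open Scope ring_scope.

(** * Leading monomials and charts *)

Section LeadingMonomials.
Variables (n : nat) (F : fieldType) (mf : measure n).
Implicit Types (p q : {mpoly F[n]}) (m : 'X_{1..n}) (s : F).

(** [mmeasure] is one more than the top weight, so a bound by [d] means that all weights are
    strictly below [d]. *)
Lemma mmeasure_leP d p :
  reflect (forall m, (d <= mf m)%N -> p@_m = 0) (mmeasure mf p <= d)%N.
Proof.
apply: (iffP idP) => [le_pd m le_dm | p0].
  by apply/memN_msupp_eq0/(mmeasure_mnm_ge (mf := mf))/(leq_trans le_pd).
rewrite mmeasureE big_seq; elim/big_ind: _ => // [a b|m m_in].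
  by rewrite geq_max => -> ->.
by rewrite ltnNge; apply: contraL m_in => /p0/eqP; rewrite mcoeff_eq0.
Qed.

Lemma mmeasureM_le p q :
  (mmeasure mf (p * q) <= (mmeasure mf p + mmeasure mf q).-1)%N.
Proof.
rewrite [mmeasure _ (p * q)]mmeasureE big_seq.
elim/big_ind: _ => // [a b|m /msuppM_le /allpairsP [[m1 m2] /= []]].
  by rewrite geq_max => -> ->.
by move=> /(mmeasure_mnm_lt mf) lt1 /(mmeasure_mnm_lt mf) lt2 ->; rewrite mfD; lia.
Qed.

Lemma mmeasure_sumX (I : eqType) (r : seq I) (c : I -> F) (e : I -> 'X_{1..n}) d :
  {in r, forall i, mf (e i) <= d}%N ->
  (mmeasure mf (\sum_(i <- r) c i *: 'X_[e i]) <= d.+1)%N.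
Proof.
move=> le_d; rewrite (leq_trans (mmeasure_sum _ _ _ _)) //.
rewrite big_seq; elim/big_ind: _ => // [a b|i r_i]; first by rewrite geq_max => -> ->.
by rewrite (leq_trans (mmeasureZ_le _ _ _)) // mmeasureX ltnS le_d.
Qed.

Definition leading p s m := (mmeasure mf (p - s *: 'X_[m]) <= mf m)%N.

Lemma leadingX m : leading 'X_[m] 1 m.
Proof. by rewrite /leading scale1r subrr mmeasure0. Qed.

Lemma leading1 : leading 1 1 0%MM.
Proof. by rewrite -mpolyX0; apply: leadingX. Qed.

(** Split each factor into leading term plus remainder: each of the other three products contains a
    remainder, hence has smaller weight. *)
Lemma leadingM p q s1 s2 m1 m2 :
  leading p s1 m1 -> leading q s2 m2 -> leading (p * q) (s1 * s2) (m1 + m2)%MM.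
Proof.
rewrite /leading => lp lq.
have -> : p * q - (s1 * s2) *: 'X_[m1 + m2] =
    (p - s1 *: 'X_[m1]) * (q - s2 *: 'X_[m2]) +
    ((s1 *: 'X_[m1]) * (q - s2 *: 'X_[m2]) +
     (p - s1 *: 'X_[m1]) * (s2 *: 'X_[m2])).
  by rewrite mpolyXD -!mul_mpolyC mpolyCM; ring.
have le_X s m : (mmeasure mf (s *: 'X_[m] : {mpoly F[n]}) <= (mf m).+1)%N.
  by rewrite (leq_trans (mmeasureZ_le _ _ _)) // mmeasureX.
rewrite mfD (leq_trans (mmeasureD_le _ _ _)) // geq_max.
apply/andP; split; last rewrite (leq_trans (mmeasureD_le _ _ _)) // geq_max.
  by rewrite (leq_trans (mmeasureM_le _ _)) //; lia.
apply/andP; split; rewrite (leq_trans (mmeasureM_le _ _)) //.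
  by move: (le_X s1 m1); lia.
by move: (le_X s2 m2); lia.
Qed.

Lemma leadingXn p s m k : leading p s m -> leading (p ^+ k) (s ^+ k) (m *+ k)%MM.
Proof.
move=> lp; elim: k => [|k IHk]; first by rewrite !expr0 mulm0n leading1.
by rewrite !exprS mulmS leadingM.
Qed.

Lemma leading_prod (I : finType) (P : pred I) (f : I -> {mpoly F[n]})
    (c : I -> F) (e : I -> 'X_{1..n}) :
  (forall i, P i -> leading (f i) (c i) (e i)) ->
  leading (\prod_(i | P i) f i) (\prod_(i | P i) c i) (\sum_(i | P i) e i)%MM.
Proof.
move=> lf; elim/big_rec3: _ => [|i m' s' p Pi]; first exact: leading1.
exact: leadingM (lf i Pi).
Qed.

Lemma mpolyX_neq0 m : 'X_[m] != 0 :> {mpoly F[n]}.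
Proof. by rewrite -(mmeasure_poly_eq0 mf) mmeasureX. Qed.

Lemma leading_coeff p s m m' : leading p s m -> (mf m <= mf m')%N ->
  p@_m' = s * (m == m')%:R.
Proof.
move=> /mmeasure_leP lp /lp /eqP; rewrite mcoeffB mcoeffZ mcoeffX subr_eq0.
by move/eqP.
Qed.

(* As f is injective, the terms of maximal weight do not cancel. *)
Lemma leading_sum (r : seq 'X_{1..n}) (c s : 'X_{1..n} -> F)
    (T : 'X_{1..n} -> {mpoly F[n]}) (f : 'X_{1..n} -> 'X_{1..n}) m :
  uniq r -> {in r, forall k, leading (T k) (s k) (f k)} ->
  {in r, forall k, c k * s k != 0} -> {in r &, injective f} ->
  (mmeasure mf (\sum_(k <- r) c k *: T k) <= (mf m).+1)%N ->
  (\sum_(k <- r) c k *: T k)@_m != 0 -> m \in map f r.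
Proof.
move=> r_uniq lT cs0 f_inj; set S := \sum_(k <- r) _ => leS Sm.
have S_coeff m' : {in r, forall k, mf (f k) <= mf m'}%N ->
    S@_m' = \sum_(k <- r) c k * s k * (f k == m')%:R.
  move=> le_m'; rewrite raddf_sum /= !big_seq; apply: eq_bigr => k r_k.
  by rewrite mcoeffZ (leading_coeff (lT k r_k)) ?le_m' // mulrA.
(* Take [j] with [f j] of maximal weight. Were it heavier than [m], injectivity would leave only the
   nonzero [c j * s j] at [f j], against [leS]. *)
have le_m : {in r, forall k, mf (f k) <= mf m}%N.
  move=> k r_k; have lt_k : (index k r < size r)%N by rewrite index_mem.
  case: (@arg_maxnP _ (Ordinal lt_k) xpredT (fun i => mf (f (nth k r i)))) => //.
  move=> i _ i_max; set j := nth k r i in i_max.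
  have r_j : j \in r by apply: mem_nth.
  have j_max : {in r, forall k', mf (f k') <= mf (f j)}%N.
    move=> k' r_k'; have lt_k' : (index k' r < size r)%N by rewrite index_mem.
    by have := i_max (Ordinal lt_k') isT; rewrite /= nth_index.
  rewrite (leq_trans (j_max k r_k)) // leqNgt; apply/negP => lt_mj.
  have /mmeasure_leP/(_ (f j) lt_mj) := leS.
  rewrite S_coeff // (bigD1_seq j) //= eqxx mulr1 big_seq_cond big1 ?addr0.
    by apply/eqP; apply: cs0.
  move=> k' /andP[r_k' ne_k'j]; rewrite -[f k' == _]/(f k' == f j).
  by rewrite (inj_in_eq f_inj) // (negPf ne_k'j) mulr0.
apply: contraNT Sm => m_nin; rewrite S_coeff // big_seq big1 // => k r_k.
by case: eqP m_nin => [<-|]; rewrite ?mulr0 // map_f.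
Qed.

End LeadingMonomials.

(** * The weights and the polynomiality criterion in a chart *)

Definition wgt (m : 'X_{1..4}) : nat := 2 * m ix + m iy + m iz + 2 * m iw.

Lemma wgt0 : wgt 0%MM = 0%N. Proof. by rewrite /wgt !mnm0E. Qed.
Lemma wgtD : {morph wgt : m1 m2 / (m1 + m2)%MM >-> (m1 + m2)%N}.
Proof. by move=> m1 m2; rewrite /wgt !mnmDE; lia. Qed.
HB.instance Definition _ := isMeasure.Build 4 wgt wgt0 wgtD.

Lemma forall_ord4 (P : 'I_4 -> Prop) : P ix -> P iy -> P iz -> P iw -> forall i, P i.
Proof.
move=> Px Py Pz Pw [[|[|[|[|//]]]] lt_i];
  [move: Px | move: Py | move: Pz | move: Pw]; congr P; exact: val_inj.
Qed.

Section Charts.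
Variable F : fieldType.
Implicit Types (G P : {mpoly F[4]}) (r : 4.-tuple (ratfun F)).

HB.instance Definition _ :=
  GRing.RMorphism.copy (@coefF F) (@tofrac {mpoly F[4]} \o @mpolyC 4 F).

(** Here [p] is the inverted coordinate, [q] its partner, and [s] normalises the chart. Multiplying
    by a power [N] of ['X_p] clears denominators; each monomial of [P] then has its own leading
    monomial, whose [p]-exponent is at most [N] plus twice its [q]-exponent. *)
Lemma chart_leading r (p q : 'I_4) (g : 'I_4 -> {mpoly F[4]})
    (s : 4.-tuple {mpoly F[4]}) (a b : F) d G :
  p != q -> wgt U_(p) = 1%N -> wgt U_(q) = 2%N ->
  tnth r p = (tofrac 'X_p)^-1 -> (forall i, i != p -> tnth r i = tofrac (g i)) ->
  'X_p \mPo s = 'X_p ->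
  (forall i, i != p -> i != q -> g i \mPo s = 'X_i) ->
  g q \mPo s = - (('X_q + b%:MP) * 'X_p + a%:MP) * 'X_p ->
  polynomial_in r G -> (mmeasure wgt (G \mPo s) <= d.+1)%N ->
  forall n, wgt n = d -> (2 * n q < n p)%N -> (G \mPo s)@_n = 0.
Proof.
move=> pq wp wq rp rg sp sg sq [P rP] Gd n wn lt_n.
pose N := \max_(m <- msupp P) m p.
have leN m : m \in msupp P -> (m p <= N)%N by move=> Pm; rewrite /N; exact: leq_bigmax_seq.
pose T (m : 'X_{1..4}) : {mpoly F[4]} := 'X_p ^+ (N - m p) * \prod_(i | i != p) (g i \mPo s) ^+ m i.
have GT : 'X_p ^+ N * (G \mPo s) = \sum_(m <- msupp P) P@_m *: T m.
  (* The identity is first checked in the fraction field, where [m p <= N] absorbs the inverse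
     powers of ['X_p]; then [s] is substituted. *)
  have : 'X_p ^+ N * G =
      \sum_(m <- msupp P) P@_m *: ('X_p ^+ (N - m p) * \prod_(i | i != p) g i ^+ m i).
    apply/eqP; rewrite -tofrac_eq tofracM -rP /mmap mulr_sumr raddf_sum /=.
    rewrite !big_seq; apply/eqP/eq_bigr => m Pm.
    rewrite -mul_mpolyC !tofracM mulrCA /mmap1 (bigD1 p) //= rp rmorph_prod /=.
    congr (_ * _); rewrite mulrA; congr (_ * _); last first.
      by apply: eq_bigr => i ip; rewrite rg // tofracXn.
    rewrite !tofracXn exprVn -expfB_cond //.
    by rewrite tofrac_eq0 (negPf (mpolyX_neq0 F wgt _)) leN.
  move/(congr1 (comp_mpoly s)); rewrite rmorphM rmorphXn /= sp => ->.
  rewrite raddf_sum; apply: eq_bigr => m _ /=.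
  rewrite comp_mpolyZ rmorphM rmorphXn /= sp rmorph_prod; congr (_ *: (_ * _)).
  by apply: eq_bigr => i _; rewrite rmorphXn.
(* [e i] is the leading exponent of the substituted [g i]: for [q] it is that of ['X_q * 'X_p ^+ 2].
   Accordingly [f m] is the leading exponent of [T m]. *)
pose e i := (U_(i) + U_(p) *+ (2 * (i == q)))%MM.
pose f (m : 'X_{1..4}) := (U_(p) *+ (N - m p) + \sum_(i | i != p) e i *+ m i)%MM.
have fp m : f m p = (N - m p + 2 * m q)%N.
  rewrite mnmDE mulmnE mnm1E eqxx mul1n mnm_sumE (bigD1 q) 1?eq_sym //=.
  rewrite big1 => [|i /andP[ip iq]]; rewrite mulmnE mnmDE mulmnE !mnm1E ?eqxx.
    by rewrite eq_sym (negPf pq); lia.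
  by rewrite (negPf ip) (negPf iq).
have fE m j : j != p -> f m j = m j.
  move=> jp; rewrite mnmDE mulmnE mnm1E eq_sym (negPf jp) mnm_sumE (bigD1 j) //=.
  rewrite big1 => [|i /andP[ip ij]]; rewrite mulmnE mnmDE mulmnE !mnm1E.
    by rewrite eqxx eq_sym (negPf jp); lia.
  by rewrite (negPf ij) eq_sym (negPf jp).
(* Exponents other than that of [p] are unchanged by [f], and [m p] is recovered from
   [N - m p + 2 * m q] because [m p <= N]. *)
have f_inj : {in msupp P &, injective f}.
  move=> m1 m2 P1 P2 /mnmP eqf; apply/mnmP => j.
  have [-> | jp] := eqVneq j p; last by rewrite -(fE m1) // eqf fE.
  have := eqf q; rewrite !fE 1?eq_sym // => eq_q.
  by have := eqf p; have := leN _ P1; have := leN _ P2; rewrite !fp eq_q; lia.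
pose c i : F := if i == q then -1 else 1.
have lh i : i != p -> leading wgt (g i \mPo s) (c i) (e i).
  rewrite /c /e => ip; have [-> | iq] := eqVneq i q; last first.
    by rewrite sg //= mulm0n addm0; apply: leadingX.
  rewrite sq /leading mpolyXD muln1 -mpolyXn scaleN1r.
  have -> : - (('X_q + b%:MP_[4]) * 'X_p + a%:MP_[4]) * 'X_p - - ('X_q * 'X_p ^+ 2)
      = (- b) *: 'X_p ^+ 2 + (- a) *: 'X_p.
    by rewrite -!mul_mpolyC !mpolyCN; ring.
  rewrite mfD mpolyXn (leq_trans (mmeasureD_le _ _ _)) // geq_max mulmS mulm1n.
  by rewrite !(leq_trans (mmeasureZ_le _ _ _)) // mmeasureX ?mfD /= wp wq.
have lT m : leading wgt (T m) (1 ^+ (N - m p) * \prod_(i | i != p) c i ^+ m i) (f m).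
  by apply/leadingM/leading_prod => [|i /lh li]; apply: leadingXn => //; apply: leadingX.
have c_neq0 m : 1 ^+ (N - m p) * \prod_(i | i != p) c i ^+ m i != 0.
  rewrite expr1n mul1r; apply/prodf_neq0 => i _; rewrite expf_neq0 // /c.
  by case: ifP; rewrite ?oppr_eq0 oner_eq0.
apply/eqP/negPn/negP => Gn.
(* A surviving monomial [n] gives [N + n p = N - m p + 2 * m q] with [m q = n q], so
   [n p <= 2 * n q]. *)
have : (U_(p) *+ N + n)%MM \in map f (msupp P).
  apply: (leading_sum (mf := wgt) (c := fun k => P@_k) (msupp_uniq P) (fun m _ => lT m) _ f_inj) => [m||].
  - by rewrite mcoeff_msupp => Pm; rewrite mulf_neq0 ?c_neq0.
  - rewrite -GT (leq_trans (mmeasureM_le _ _ _)) // mpolyXn mmeasureX mfD /= wn.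
    by move: Gd; lia.
  - by rewrite -GT [_ * (_ \mPo _)]mulrC mpolyXn mcoeffMX.
case/mapP => m Pm eq_m; have := congr1 (fun k : 'X_{1..4} => k q) eq_m.
have := congr1 (fun k : 'X_{1..4} => k p) eq_m.
rewrite fp (fE m q) 1?eq_sym // !mnmDE !mulmnE !mnm1E eqxx (negPf pq) /= => eqp eqq.
by move: lt_n eqp; rewrite -eqq; lia.
Qed.

End Charts.

(** * Integer linear algebra on leading forms *)

(** A computable copy of the integer polynomials in four variables, with repeated terms allowed, so
    that the rank checks run by [vm_compute]. *)
Definition exponent := seq nat.
Definition sparse := seq (int * exponent).

(* Missing entries of an exponent count as zero. *)
Definition mon (e : exponent) : 'X_{1..4} := [multinom nth 0%N e i | i < 4].
Definition exponents_of (m : 'X_{1..4}) : exponent := [:: m ix; m iy; m iz; m iw].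

Definition exp_add (e f : exponent) : exponent :=
  [seq (nth 0 e i + nth 0 f i)%N | i <- iota 0 4].
Definition exp_eq (e f : exponent) :=
  all (fun i => nth 0%N e i == nth 0%N f i) (iota 0 4).
Definition exp_wgt (e : exponent) :=
  (2 * nth 0 e 0 + nth 0 e 1 + nth 0 e 2 + 2 * nth 0 e 3)%N.

Definition sp_mul (p q : sparse) : sparse :=
  [seq (u.1 * v.1, exp_add u.2 v.2) | u <- p, v <- q].
Definition sp_exp (p : sparse) k : sparse := iter k (sp_mul p) [:: (1, [::])].
Definition sp_subst_mon (s : seq sparse) (e : exponent) : sparse :=
  foldr sp_mul [:: (1, [::])]
    [seq sp_exp (nth [::] s i) (nth 0%N e i) | i <- iota 0 4].
Definition sp_subst (s : seq sparse) (p : sparse) : sparse :=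
  flatten [seq sp_mul [:: (u.1, [::])] (sp_subst_mon s u.2) | u <- p].
Definition sp_coef (p : sparse) (e : exponent) : int :=
  foldr (fun u c => if exp_eq u.2 e then u.1 + c else c) 0 p.

Fixpoint exponents n d : seq exponent :=
  if n is n'.+1 then [seq x :: e | x <- iota 0 d.+1, e <- exponents n' d]
  else [:: [::]].
(** Entries up to [d] suffice, as every variable has weight at least 1. *)
Definition exponents_wgt d := [seq e <- exponents 4 d | exp_wgt e == d].

(** The matrix of the conditions of [chart_leading]: a row per forbidden monomial of weight [d], a
    column per polynomial of [cs]. *)
Definition rows d (s : seq sparse) (p q : nat) (cs : seq sparse) : seq (seq Z) :=
  let cs' := [seq sp_subst s f | f <- cs] in
  [seq [seq Z_of_int (sp_coef f n) | f <- cs']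
     | n <- exponents_wgt d & (2 * nth 0 n q < nth 0 n p)%N].

(* The elimination is carried out in the binary integers Z, since int is unary. *)
Definition reduce (p r : seq Z) : seq Z :=
  let a := head Z0 p in let b := head Z0 r in
  if Z.eqb b Z0 then behead r
  else [seq Z.sub (Z.mul a u.1) (Z.mul b u.2) | u <- zip (behead r) (behead p)].

(** Fraction-free Gaussian elimination, testing independence of the columns. The pivot row may stay
    in the list, since reducing it by itself gives a zero row. *)
Fixpoint full_rank n (m : seq (seq Z)) : bool :=
  if n is n'.+1 then
    if [seq r <- m | ~~ Z.eqb (head Z0 r) Z0] is p :: _
    then full_rank n' [seq reduce p r | r <- m] else false
  else true.

Lemma mon_exponents_of m : mon (exponents_of m) = m.
Proof. by apply/mnmP; elim/forall_ord4; rewrite mnmE. Qed.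

Lemma mon_add e f : mon (exp_add e f) = (mon e + mon f)%MM.
Proof. by apply/mnmP; elim/forall_ord4; rewrite mnmDE !mnmE. Qed.

Lemma mon_nil : mon [::] = 0%MM.
Proof. by apply/mnmP; elim/forall_ord4; rewrite mnmE mnm0E. Qed.

Lemma mon_eq e f : (mon e == mon f) = exp_eq e f.
Proof.
apply/eqP/and5P => [/mnmP eqef | [/eqP e0 /eqP e1 /eqP e2 /eqP e3 _]].
  by split=> //; apply/eqP; [have := eqef ix | have := eqef iy | have := eqef iz
    | have := eqef iw]; rewrite !mnmE.
by apply/mnmP; elim/forall_ord4; rewrite !mnmE.
Qed.

Lemma wgt_mon e : wgt (mon e) = exp_wgt e.
Proof. by rewrite /wgt !mnmE. Qed.

Lemma mem_exponents n d e :
  (e \in exponents n d) = (size e == n) && all (fun k => k <= d)%N e.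
Proof.
elim: n e => [|n IHn] e; first by case: e.
apply/allpairsP/idP => [[[k f] [k_in f_in ->]] | ].
  move: f_in k_in; rewrite IHn mem_iota /= eqSS => /andP[-> ->].
  by rewrite add0n ltnS => ->.
case: e => // k e /andP[sz /andP[le_k le_e]]; exists (k, e).
split=> //; first by rewrite mem_iota add0n ltnS.
by rewrite IHn; apply/andP.
Qed.

Lemma exponents_uniq n d : uniq (exponents n d).
Proof.
elim: n => // n IHn; apply: allpairs_uniq (iota_uniq _ _) IHn _.
by move=> [x e] [y f] _ _ [-> ->].
Qed.

Lemma mem_exponents_wgt d m :
  (exponents_of m \in exponents_wgt d) = (wgt m == d).
Proof.
rewrite mem_filter mem_exponents -wgt_mon mon_exponents_of /=.
by case: eqP => //= <-; rewrite /wgt; apply/and5P; split=> //; lia.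
Qed.

(** * Evaluation of sparse polynomials and of the rank test over a field *)

Section SparseEval.
Variable F : fieldType.
Hypothesis char0 : forall k, k.+1%:R != 0 :> F.

Definition sp_val (p : sparse) : {mpoly F[4]} := \sum_(u <- p) u.1%:~R *: 'X_[mon u.2].

Lemma sp_val1 : sp_val [:: (1, [::])] = 1.
Proof. by rewrite /sp_val big_seq1 mon_nil mpolyX0 scale1r. Qed.

Lemma sp_val_mul p q : sp_val (sp_mul p q) = sp_val p * sp_val q.
Proof.
rewrite /sp_val big_allpairs_dep mulr_suml; apply: eq_bigr => u _.
rewrite mulr_sumr; apply: eq_bigr => v _ /=.
by rewrite mon_add mpolyXD rmorphM /= -scalerAl -scalerAr scalerA.
Qed.

Lemma sp_val_exp p k : sp_val (sp_exp p k) = sp_val p ^+ k.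
Proof. by elim: k => [|k IHk]; rewrite ?sp_val1 // exprS -IHk -sp_val_mul. Qed.

Definition sp_tuple (s : seq sparse) : 4.-tuple {mpoly F[4]} :=
  [tuple sp_val (nth [::] s i) | i < 4].

Lemma sp_val_subst_mon s e : sp_val (sp_subst_mon s e) = 'X_[mon e] \mPo sp_tuple s.
Proof.
rewrite comp_mpolyX !big_ord_recr big_ord0 /= !tnth_mktuple !mnmE mul1r.
by rewrite !sp_val_mul !sp_val_exp sp_val1 mulr1 !mulrA.
Qed.

Lemma sp_val_subst s p : sp_val (sp_subst s p) = sp_val p \mPo sp_tuple s.
Proof.
rewrite /sp_val big_flatten big_map raddf_sum /=; apply: eq_bigr => u _.
rewrite -[LHS]/(sp_val _) sp_val_mul sp_val_subst_mon comp_mpolyZ.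
by rewrite /sp_val big_seq1 mon_nil mpolyX0 mulr_algl.
Qed.

Lemma sp_val_coef p e : (sp_val p)@_(mon e) = (sp_coef p e)%:~R.
Proof.
rewrite /sp_val raddf_sum /=; elim: p => [|u p IHp]; first by rewrite big_nil.
rewrite big_cons IHp mcoeffZ mcoeffX mon_eq /=.
by case: ifP; rewrite ?mulr1 ?mulr0 ?add0r ?rmorphD.
Qed.

Definition ZF (z : Z) : F := (int_of_Z z)%:~R.

Lemma ZF_eq0 z : ZF z = 0 -> z = Z0.
Proof.
rewrite /ZF => z0; apply: (can_inj int_of_ZK); move: z0.
case: (int_of_Z z) => [[|k]|k] //.
  by rewrite -pmulrn => /eqP; rewrite (negPf (char0 k)).
by rewrite NegzE mulrNz -pmulrn => /eqP; rewrite oppr_eq0 (negPf (char0 k)).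
Qed.

Lemma ZF_subM a b a' b' :
  ZF (Z.sub (Z.mul a b') (Z.mul b a')) = ZF a * ZF b' - ZF b * ZF a'.
Proof. by rewrite /ZF -!intrM -intrB -!(rmorphM int_of_Z) -(rmorphB int_of_Z). Qed.

Definition dot (v : seq F) (r : seq Z) : F := \sum_(u <- zip v r) u.1 * ZF u.2.

Lemma dot_reduce x v p r : size p = (size v).+1 -> size r = (size v).+1 ->
  dot (x :: v) p = 0 -> dot (x :: v) r = 0 -> dot v (reduce p r) = 0.
Proof.
case: p r => [//|a p] [//|b r] [sp] [sr]; rewrite /dot /= !big_cons /= -!/(dot _ _).
rewrite /reduce /=; case: Z.eqb_spec => [-> _ | _ dp dr].
  by rewrite /ZF mulr0 add0r.
have -> : dot v [seq Z.sub (Z.mul a u.1) (Z.mul b u.2) | u <- zip r p]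
    = ZF a * dot v r - ZF b * dot v p.
  elim: v p r sp sr {dp dr} => [|y v IHv] [|a' p] [|b' r] //=.
    by rewrite /dot !big_nil !mulr0 subrr.
  move=> [sp] [sr]; rewrite /dot /= !big_cons /= -!/(dot _ _) IHv // ZF_subM.
  ring.
have -> : dot v r = - (x * ZF b) by apply/eqP; rewrite -addr_eq0 addrC dr.
have -> : dot v p = - (x * ZF a) by apply/eqP; rewrite -addr_eq0 addrC dp.
ring.
Qed.

(** The reduced rows no longer involve the first unknown, so by induction the others vanish; the
    pivot, nonzero in characteristic 0, then kills the first. *)
Lemma full_rankP v m : full_rank (size v) m -> {in m, forall r, size r = size v} ->
  {in m, forall r, dot v r = 0} -> all (pred1 0) v.
Proof.
elim: v m => //= x v IHv m.
case piv: [seq _ <- _ | _] => [//|p t] rk sz dot0.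
have /andP[p0 m_p] : (~~ Z.eqb (head Z0 p) Z0) && (p \in m).
  by rewrite -(mem_filter (fun r => ~~ Z.eqb (head Z0 r) Z0)) piv mem_head.
have v0 : all (pred1 0) v.
  apply: IHv rk _ _ => _ /mapP[r m_r ->].
    have := sz _ m_r; have := sz _ m_p; case: p r {piv p0 m_p m_r} => [|a p] [|b r] //= [sp] [sr].
    by rewrite /reduce /=; case: ifP => // _; rewrite size_map size_zip sp sr minnn.
  by apply: (@dot_reduce x); rewrite ?sz ?dot0.
rewrite v0 andbT; have := dot0 _ m_p; have := sz _ m_p.
case: p p0 {piv m_p rk} => // a p /= a0 [sp]; rewrite /dot /= big_cons -/(dot _ _).
have -> : dot v p = 0.
  rewrite /dot; elim: v p sp v0 {IHv sz dot0} => [|y v IHv] [|b p] //=; rewrite ?big_nil //.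
  by move=> [sp] /andP[/eqP-> v0]; rewrite big_cons mul0r add0r IHv.
rewrite addr0 => /eqP; rewrite mulf_eq0 => /orP[// | /eqP/ZF_eq0 /= a_eq0].
by rewrite a_eq0 in a0.
Qed.

Definition lincomb (v : seq F) (cs : seq sparse) : {mpoly F[4]} :=
  \sum_(u <- zip v cs) u.1 *: sp_val u.2.

(** Pairing [v] with a row yields the coefficient of the substituted combination at the forbidden
    monomial of that row. *)
Lemma dot_rows d s (p q : 'I_4) v cs :
  (forall n, wgt n = d -> (2 * n q < n p)%N -> (lincomb v cs \mPo sp_tuple s)@_n = 0) ->
  {in rows d s p q cs, forall r, dot v r = 0}.
Proof.
move=> G0 r /mapP[n]; rewrite mem_filter => /andP[lt_n].
rewrite mem_filter => /andP[/eqP wn _] ->{r}.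
have := G0 (mon n); rewrite wgt_mon !mnmE => /(_ wn lt_n) <-.
rewrite /lincomb /dot; elim: v cs {G0} => [|x v IHv] [|f cs]; rewrite /= ?big_nil ?comp_mpoly0 ?mcoeff0 //.
rewrite !big_cons comp_mpolyD mcoeffD comp_mpolyZ mcoeffZ -sp_val_subst sp_val_coef.
by rewrite IHv /ZF /= Z_of_intK.
Qed.

Lemma size_rows d s p q cs : {in rows d s p q cs, forall r, size r = size cs}.
Proof. by move=> r /mapP[n _ ->]; rewrite !size_map. Qed.

End SparseEval.

(** * Leading forms in the three charts *)

Definition xyzw (i j k l : nat) : exponent := [:: i; j; k; l].

(* shift1 undoes (x, w) -> (x + z^2, w - 2 y z) and shift2 undoes
   (x, z) -> (x + y^2 + w, z + y); in these coordinates r_1 and r_2 move x and y only. *)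
Definition shift0 : seq sparse :=
  [:: [:: (1, xyzw 1 0 0 0)]; [:: (1, xyzw 0 1 0 0)];
      [:: (1, xyzw 0 0 1 0)]; [:: (1, xyzw 0 0 0 1)]].
Definition shift1 : seq sparse :=
  [:: [:: (1, xyzw 1 0 0 0); (-1, xyzw 0 0 2 0)]; [:: (1, xyzw 0 1 0 0)];
      [:: (1, xyzw 0 0 1 0)]; [:: (1, xyzw 0 0 0 1); (2, xyzw 0 1 1 0)]].
Definition shift2 : seq sparse :=
  [:: [:: (1, xyzw 1 0 0 0); (-1, xyzw 0 2 0 0); (-1, xyzw 0 0 0 1)];
      [:: (1, xyzw 0 1 0 0)];
      [:: (1, xyzw 0 0 1 0); (-1, xyzw 0 1 0 0)]; [:: (1, xyzw 0 0 0 1)]].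

Section ChartsLeading.
Variable F : fieldType.
Implicit Types (G : {mpoly F[4]}) (s : seq sparse).

Lemma mmeasure_sp_val p d : all (fun u => exp_wgt u.2 <= d)%N p ->
  (mmeasure wgt (sp_val F p) <= d.+1)%N.
Proof.
by move=> /allP le_d; apply: mmeasure_sumX => u p_u; rewrite /= wgt_mon le_d.
Qed.

Lemma mmeasure_comp_le (s : 4.-tuple {mpoly F[4]}) G :
  (forall i, mmeasure wgt (tnth s i) <= (wgt U_(i)).+1)%N ->
  (mmeasure wgt (G \mPo s) <= mmeasure wgt G)%N.
Proof.
move=> le_s; rewrite comp_mpolyEX (leq_trans (mmeasure_sum _ _ _ _)) //.
rewrite big_seq; elim/big_ind: _ => // [a b|m Gm]; first by rewrite geq_max => -> ->.
rewrite (leq_trans (mmeasureZ_le _ _ _)) // comp_mpolyX.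
apply: leq_trans (mmeasure_mnm_lt wgt Gm); rewrite mfE.
elim/big_rec2: _ => [|i k p _ le_p]; first by rewrite mmeasure1.
rewrite (leq_trans (mmeasureM_le _ _ _)) //=.
suff : (mmeasure wgt (tnth s i ^+ m i) <= (m i * wgt U_(i)).+1)%N.
  by move: le_p; lia.
elim: (m i) => [|j IHj]; first by rewrite expr0 mmeasure1.
by rewrite exprS (leq_trans (mmeasureM_le _ _ _)) //; move: IHj (le_s i) => /=; rewrite mulSn; lia.
Qed.

(** [rcons (nseq i 0) 1] is the exponent of the [i]-th variable: the test says that substituting [s]
    raises no weight. *)
Definition graded s :=
  all (fun i => all (fun u => exp_wgt u.2 <= exp_wgt (rcons (nseq i 0%N) 1%N))%N (nth [::] s i))
    (iota 0 4).

Lemma mmeasure_graded s G : graded s ->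
  (mmeasure wgt (G \mPo sp_tuple F s) <= mmeasure wgt G)%N.
Proof.
move=> /and5P[g0 g1 g2 g3 _]; apply: mmeasure_comp_le.
by elim/forall_ord4; rewrite tnth_mktuple /wgt !mnm1E mmeasure_sp_val.
Qed.

Lemma mpolyX_mon e : 'X_[mon e] = 'X_ix ^+ nth 0%N e 0 * 'X_iy ^+ nth 0%N e 1 *
  'X_iz ^+ nth 0%N e 2 * 'X_iw ^+ nth 0%N e 3 :> {mpoly F[4]}.
Proof.
rewrite mpolyXE_id !big_ord_recr big_ord0 /= !mnmE mul1r.
by do ![congr (_ * _)]; congr ('X_ _ ^+ _); apply: val_inj.
Qed.

Lemma sp_val_nil : sp_val F [::] = 0.
Proof. by rewrite /sp_val big_nil. Qed.

Lemma sp_val_cons u p : sp_val F (u :: p) = 'X_[mon u.2] *~ u.1 + sp_val F p.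
Proof. by rewrite /sp_val big_cons scaler_int. Qed.

Definition sp_valE := (sp_val_cons, sp_val_nil, mpolyX_mon).

Lemma comp_sp_tuple s i : 'X_i \mPo sp_tuple F s = sp_val F (nth [::] s i).
Proof. by rewrite comp_mpolyXU -tnth_nth tnth_mktuple. Qed.

Definition chart_vanishing d s (p q : 'I_4) G :=
  forall n, wgt n = d -> (2 * n q < n p)%N -> (G \mPo sp_tuple F s)@_n = 0.

Let x : {mpoly F[4]} := 'X_ix.
Let y : {mpoly F[4]} := 'X_iy.
Let z : {mpoly F[4]} := 'X_iz.
Let w : {mpoly F[4]} := 'X_iw.

Lemma r0_vanishing (a0 : F) d G : polynomial_in (r0 a0) G ->
  (mmeasure wgt G <= d.+1)%N -> chart_vanishing d shift0 iz iw G.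
Proof.
(* The entry 0 at the inverted coordinate is a placeholder: [g] is constrained only at the other
   indices. *)
move=> rG Gd; apply: (@chart_leading F _ iz iw
    (fun i => nth 0 [:: x; y; 0; - (w * z + a0%:MP) * z] i) _ a0 0 d _ _ _ _ _ _ _ _ _ rG).
- by [].
- by rewrite /wgt !mnm1E.
- by rewrite /wgt !mnm1E.
- by rewrite (tnth_nth 0).
- by elim/forall_ord4 => // _; rewrite (tnth_nth 0) //= rmorphM rmorphN rmorphD rmorphM.
- by rewrite comp_sp_tuple !sp_valE /=; ring.
- elim/forall_ord4 => //= _ _; rewrite comp_sp_tuple !sp_valE /=; ring.
- rewrite /= rmorphM rmorphN rmorphD rmorphM /= comp_mpolyC !comp_sp_tuple !sp_valE /=; ring.
- exact: leq_trans (mmeasure_graded _ _) Gd.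
Qed.

Lemma r1_vanishing (a1 : F) d G : polynomial_in (r1 a1) G ->
  (mmeasure wgt G <= d.+1)%N -> chart_vanishing d shift1 iy ix G.
Proof.
move=> rG Gd; apply: (@chart_leading F _ iy ix
    (fun i => nth 0 [:: - ((x + z ^+ 2) * y - a1%:MP) * y; 0; z; w - 2%:R * y * z] i)
    _ (- a1) 0 d _ _ _ _ _ _ _ _ _ rG).
- by [].
- by rewrite /wgt !mnm1E.
- by rewrite /wgt !mnm1E.
- by rewrite (tnth_nth 0).
- elim/forall_ord4 => // _; rewrite (tnth_nth 0) //=.
    by rewrite rmorphM rmorphN rmorphB rmorphM rmorphD rmorphXn.
  by rewrite rmorphB !rmorphM rmorph_nat.
- by rewrite comp_sp_tuple !sp_valE /=; ring.
- elim/forall_ord4 => //= _ _; rewrite ?(rmorphB, rmorphM, rmorph_nat) /=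
    !comp_sp_tuple !sp_valE /=; ring.
- rewrite /= rmorphM rmorphN rmorphB rmorphM rmorphD rmorphXn /= comp_mpolyC.
  rewrite !comp_sp_tuple !sp_valE /= rmorphN /=; ring.
- exact: leq_trans (mmeasure_graded _ _) Gd.
Qed.

Lemma r2_vanishing (t a2 : F) d G : polynomial_in (r2 t a2) G ->
  (mmeasure wgt G <= d.+1)%N -> chart_vanishing d shift2 iy ix G.
Proof.
(* Once [shift2] has turned x + y^2 + w into x, the remaining [t] plays the part of the constant
   [b]. *)
move=> rG Gd; apply: (@chart_leading F _ iy ix
    (fun i => nth 0 [:: - ((x + y ^+ 2 + w + t%:MP) * y - a2%:MP) * y; 0; z + y; w] i)
    _ (- a2) t d _ _ _ _ _ _ _ _ _ rG).
- by [].
- by rewrite /wgt !mnm1E.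
- by rewrite /wgt !mnm1E.
- by rewrite (tnth_nth 0).
- elim/forall_ord4 => // _; rewrite (tnth_nth 0) //=.
    by rewrite rmorphM rmorphN rmorphB rmorphM !rmorphD rmorphXn.
  by rewrite rmorphD.
- by rewrite comp_sp_tuple !sp_valE /=; ring.
- elim/forall_ord4 => //= _ _; rewrite ?rmorphD /= !comp_sp_tuple !sp_valE /=; ring.
- rewrite /= rmorphM rmorphN rmorphB rmorphM !rmorphD rmorphXn /= !comp_mpolyC.
  rewrite !comp_sp_tuple !sp_valE /= rmorphN /=; ring.
- exact: leq_trans (mmeasure_graded _ _) Gd.
Qed.

End ChartsLeading.

(** * Descent on the weight *)

(* x^2 and x^4 are left out: subtracting multiples of H and H^2 removes them from K. *)
Definition unknowns d : seq exponent :=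
  [seq e <- exponents_wgt d |
     (sumn e <= 6)%N && (e \notin [:: xyzw 2 0 0 0; xyzw 4 0 0 0])].

(* H is polynomial in r_2 only up to eta y: the leading forms 2 y H and y, in
   weights 5 and 1, come with the coefficients - c2 eta and 1 - c1 eta, which are
   treated as further unknowns. *)
Definition defect d : seq sparse :=
  if d == 5%N then
    [:: [:: (4, xyzw 1 3 0 0); (4, xyzw 2 1 0 0); (2, xyzw 0 1 2 1);
            (-1, xyzw 0 1 0 2); (2, xyzw 1 1 0 1); (4, xyzw 0 2 1 1)]]
  else if d == 1%N then [:: [:: (1, xyzw 0 1 0 0)]] else [::].

(** The defect enters only in r_2; in r_0 and r_1 its columns are padded by zero polynomials. *)
Definition leading_rows d : seq (seq Z) :=
  let ms := [seq [:: (1, e)] | e <- unknowns d] in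
  let zs := [seq [::] | _ <- defect d] in
  rows d shift0 2 3 (ms ++ zs) ++ rows d shift1 1 0 (ms ++ zs)
    ++ rows d shift2 1 0 (ms ++ defect d).

(** Weight 12 is the maximum in degree 6, so this is a finite check on integer matrices free of
    parameters. *)
Lemma leading_rows_full_rank d : (0 < d <= 12)%N ->
  full_rank (size (unknowns d) + size (defect d)) (leading_rows d).
Proof.
have /allP rk : all (fun d => full_rank (size (unknowns d) + size (defect d)) (leading_rows d))
  (iota 1 12) by vm_compute.
by move=> lt_d; apply: rk; rewrite mem_iota.
Qed.

Section Descent.
Variable F : fieldType.
Hypothesis char0 : forall k, k.+1%:R != 0 :> F.
Implicit Types (G K B : {mpoly F[4]}) (s : seq sparse).

(** The conditions in weight [d] see only the leading form, because a graded substitution keeps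
    terms of lower weight below [d]. *)
Lemma chart_vanishing_leading d s p q G G' : graded s ->
  (mmeasure wgt (G - G') <= d)%N ->
  chart_vanishing d s p q G -> chart_vanishing d s p q G'.
Proof.
move=> gs le_d van n wn lt_n; rewrite -[G'](subKr G) comp_mpolyB mcoeffB van //.
have /mmeasure_leP -> := leq_trans (mmeasure_graded _ gs) le_d; rewrite ?subrr //=.
by rewrite wn.
Qed.

Lemma lincomb_cat (u v : seq F) cs ds : size u = size cs ->
  lincomb (u ++ v) (cs ++ ds) = lincomb u cs + lincomb v ds.
Proof. by move=> sz; rewrite /lincomb zip_cat // big_cat. Qed.

Lemma lincomb_nil_cols (v : seq F) (T : Type) (cs : seq T) :
  lincomb v [seq [::] | _ <- cs] = 0.
Proof.
rewrite /lincomb; elim: v cs => [|x v IHv] [|c cs]; rewrite /= ?big_nil // big_cons IHv.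
by rewrite sp_val_nil scaler0 addr0.
Qed.

Lemma lincomb_mon (c : exponent -> F) es :
  lincomb (map c es) [seq [:: (1, e)] | e <- es] = \sum_(e <- es) c e *: 'X_[mon e].
Proof.
rewrite /lincomb; elim: es => [|e es IHe]; rewrite /= ?big_nil // !big_cons IHe.
by rewrite sp_val_cons sp_val_nil addr0 mulr1z.
Qed.

Lemma exponents_of_mon e : size e = 4%N -> exponents_of (mon e) = e.
Proof.
by case: e => [|? [|? [|? [|? []]]]] // _; rewrite /exponents_of !mnmE.
Qed.

Lemma mdeg_exponents_of m : mdeg m = sumn (exponents_of m).
Proof.
rewrite mdegE !big_ord_recr big_ord0 /= addn0 !addnA.
by do ![congr addn]; congr (fun_of_multinom _ _); apply: val_inj.
Qed.

Lemma unknownsP d m : (exponents_of m \in unknowns d) =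
  [&& wgt m == d, (mdeg m <= 6)%N, m != mon (xyzw 2 0 0 0) & m != mon (xyzw 4 0 0 0)].
Proof.
rewrite mem_filter mem_exponents_wgt andbC !inE negb_or -mdeg_exponents_of.
have eqE e : size e = 4%N -> (exponents_of m == e) = (m == mon e).
  move=> sz; apply/eqP/eqP => [<- | ->]; first by rewrite mon_exponents_of.
  exact: exponents_of_mon.
by rewrite !eqE.
Qed.

(** The degree bound and the two vanishing coefficients rule out exactly the monomials of weight [d]
    that [unknowns d] omits. *)
Lemma leading_expansion d K : (mmeasure wgt K <= d.+1)%N -> (msize K <= 7)%N ->
  K@_(mon (xyzw 2 0 0 0)) = 0 -> K@_(mon (xyzw 4 0 0 0)) = 0 ->
  (mmeasure wgt (K - \sum_(e <- unknowns d) K@_(mon e) *: 'X_[mon e]) <= d)%N.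
Proof.
move=> /mmeasure_leP Kd /mmeasure_leP K7 K2 K4; apply/mmeasure_leP => m le_dm.
have sz e : e \in unknowns d -> size e = 4%N.
  by rewrite !mem_filter mem_exponents => /and3P[_ _ /andP[/eqP]].
rewrite mcoeffB raddf_sum /=; apply/eqP; rewrite subr_eq0; apply/eqP.
have [m_in | m_nin] := boolP (exponents_of m \in unknowns d).
  rewrite (bigD1_seq _ m_in) ?filter_uniq ?exponents_uniq //= big_seq_cond big1.
    by rewrite addr0 mon_exponents_of mcoeffZ mcoeffX eqxx mulr1.
  move=> e /andP[/sz sz_e ne_e]; rewrite mcoeffZ mcoeffX.
  case: eqP => [eq_m|]; last by rewrite mulr0.
  by rewrite -eq_m exponents_of_mon ?eqxx in ne_e.
rewrite big_seq big1 => [|e e_in]; last first.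
  rewrite mcoeffZ mcoeffX; case: eqP => [eq_m|]; last by rewrite mulr0.
  by move: m_nin; rewrite -eq_m exponents_of_mon ?e_in ?sz.
have [wm | ne_d] := eqVneq (wgt m) d; last by apply: Kd; rewrite ltn_neqAle eq_sym ne_d.
move: m_nin; rewrite unknownsP wm eqxx /= !negb_and !negbK.
by case/or3P => [|/eqP->|/eqP->] //; rewrite -ltnNge; apply: K7.
Qed.

(** [B] corrects [K] in r_2 and has leading form given by [us]. The leading coefficients of [K]
    followed by [us] solve a system of full column rank, so all vanish together. *)
Lemma descent_step (t a0 a1 a2 : F) d K B (us : seq F) :
  (0 < d <= 12)%N -> (mmeasure wgt K <= d.+1)%N -> (msize K <= 7)%N ->
  K@_(mon (xyzw 2 0 0 0)) = 0 -> K@_(mon (xyzw 4 0 0 0)) = 0 ->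
  (mmeasure wgt B <= d.+1)%N -> size us = size (defect d) ->
  (mmeasure wgt (B - lincomb us (defect d)) <= d)%N ->
  polynomial_in (r0 a0) K -> polynomial_in (r1 a1) K -> polynomial_in (r2 t a2) (K + B) ->
  (mmeasure wgt K <= d)%N /\ all (pred1 0) us.
Proof.
move=> d_bd Kd K7 K2 K4 Bd sz_us B_us K_r0 K_r1 K_r2.
have le_KG := leading_expansion Kd K7 K2 K4; set G := \sum_(e <- _) _ in le_KG.
pose cK := [seq K@_(mon e) | e <- unknowns d].
pose ms : seq sparse := [seq [:: (1, e)] | e <- unknowns d].
have GE : lincomb cK ms = G by apply: (lincomb_mon (fun e => K@_(mon e))).
have sz_cK : size cK = size ms by rewrite !size_map.
have le_KBd : (mmeasure wgt (K + B) <= d.+1)%N.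
  by rewrite (leq_trans (mmeasureD_le _ _ _)) // geq_max Kd.
have le_KBG : (mmeasure wgt (K + B - (G + lincomb us (defect d))) <= d)%N.
  by rewrite opprD addrACA (leq_trans (mmeasureD_le _ _ _)) // geq_max le_KG.
have : all (pred1 0) (cK ++ us).
  have := leading_rows_full_rank d_bd.
  have -> : (size (unknowns d) + size (defect d))%N = size (cK ++ us).
    by rewrite size_cat size_map sz_us.
  move/(full_rankP char0); apply=> r.
    rewrite !mem_cat => /or3P[] /size_rows ->;
      by rewrite !size_cat !size_map sz_us.
  have G0 : lincomb (cK ++ us) (ms ++ [seq [::] | _ <- defect d]) = G.
    by rewrite lincomb_cat // GE lincomb_nil_cols addr0.
  rewrite !mem_cat => /or3P[]; move: r.
  - apply: (@dot_rows F d shift0 iz iw) => n wn lt_n; rewrite G0.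
    exact: (chart_vanishing_leading _ le_KG (r0_vanishing K_r0 Kd)).
  - apply: (@dot_rows F d shift1 iy ix) => n wn lt_n; rewrite G0.
    exact: (chart_vanishing_leading _ le_KG (r1_vanishing K_r1 Kd)).
  - apply: (@dot_rows F d shift2 iy ix) => n wn lt_n; rewrite lincomb_cat // GE.
    exact: (chart_vanishing_leading _ le_KBG (r2_vanishing K_r2 le_KBd)).
rewrite all_cat => /andP[/allP cK0 us0]; split=> //.
suff G0 : G = 0 by move: le_KG; rewrite G0 subr0.
rewrite /G big_seq big1 // => e e_in.
by have /eqP -> : K@_(mon e) == 0; [apply/cK0/map_f | rewrite scale0r].
Qed.

End Descent.

(** * The Hamiltonian H *)

Section PolynomialIn.
Variables (F : fieldType) (r : 4.-tuple (ratfun F)).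
Implicit Types G : {mpoly F[4]}.

Lemma polynomial_inD G1 G2 :
  polynomial_in r G1 -> polynomial_in r G2 -> polynomial_in r (G1 + G2).
Proof.
by move=> [P1 e1] [P2 e2]; exists (P1 + P2); rewrite rmorphD /= e1 e2 -rmorphD.
Qed.

Lemma polynomial_inM G1 G2 :
  polynomial_in r G1 -> polynomial_in r G2 -> polynomial_in r (G1 * G2).
Proof.
by move=> [P1 e1] [P2 e2]; exists (P1 * P2); rewrite rmorphM /= e1 e2 -rmorphM.
Qed.

Lemma polynomial_inZ c G : polynomial_in r G -> polynomial_in r (c *: G).
Proof.
move=> [P e]; exists (c%:MP * P).
by rewrite rmorphM /= mmapC e -mul_mpolyC rmorphM.
Qed.

End PolynomialIn.

Section ChartIdentities.
Variables (L : fieldType) (x y z w t a0 a1 a2 : L).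
Hypothesis two_neq0 : 2 != 0 :> L.

Let H := 2%:R * x * y ^+ 2 + 2%:R * x ^+ 2 + 2%:R * t * x - 2%:R * a1 * y
  + z ^+ 2 * w - 2%:R^-1 * w ^+ 2 + a0 * z + x * w + 2%:R * y * z * w.

(** Here w = -(w' z' + a0) z', so z^2 w + a0 z collapses to -w'. *)
Lemma H_in_r0 : z != 0 ->
  let z' := z^-1 in let w' := - (w * z + a0) * z in
  2%:R * x * y ^+ 2 + 2%:R * x ^+ 2 + 2%:R * t * x - 2%:R * a1 * y - w'
    - 2%:R^-1 * ((w' * z' + a0) * z') ^+ 2 - x * (w' * z' + a0) * z'
    - 2%:R * y * (w' * z' + a0) = H.
Proof. by move=> z_neq0; rewrite /H /=; field; rewrite z_neq0 two_neq0. Qed.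

(** [u] is x + z^2 and [uy] is (x + z^2) y in the new coordinates; 2 y (uy - a1) equals -2 x'. *)
Lemma H_in_r1 : y != 0 ->
  let x' := - ((x + z ^+ 2) * y - a1) * y in let y' := y^-1 in
  let w' := w - 2%:R * y * z in
  let uy := - (x' * y' - a1) in let u := uy * y' in
  - 2%:R * x' + 2%:R * (u - z ^+ 2) ^+ 2 + 2%:R * t * (u - z ^+ 2)
    - 2%:R^-1 * w' ^+ 2 + a0 * z + u * w' + 2%:R * z * uy = H.
Proof. by move=> y_neq0; rewrite /H /=; field; rewrite y_neq0 two_neq0. Qed.

(** [v] is x + y^2 + w + t in the new coordinates; adding eta y cancels the pole of H along y' =
    0. *)
Lemma H_in_r2 : y != 0 ->
  let x' := - ((x + y ^+ 2 + w + t) * y - a2) * y in let y' := y^-1 in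
  let z' := z + y in
  let v := - (x' * y' - a2) * y' in
  2%:R * x' + 2%:R * (v - w - t) * (v - w) + z' ^+ 2 * w - 2%:R^-1 * w ^+ 2
    + a0 * z' + (v - w - t) * w = H + (a0 + 2%:R * a1 + 2%:R * a2) * y.
Proof. by move=> y_neq0; rewrite /H /=; field; rewrite y_neq0 two_neq0. Qed.

End ChartIdentities.

Section Solution.
Variable F : fieldType.
Hypothesis char0 : forall k, k.+1%:R != 0 :> F.
Variables t a0 a1 a2 : F.

Let x : {mpoly F[4]} := 'X_ix.
Let y : {mpoly F[4]} := 'X_iy.
Let z : {mpoly F[4]} := 'X_iz.
Let w : {mpoly F[4]} := 'X_iw.
Let H := HamH t a0 a1.
Let eta := a0 + 2%:R * a1 + 2%:R * a2.

Lemma tofrac_HamH (X Y Z W : ratfun F) :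
  X = tofrac x -> Y = tofrac y -> Z = tofrac z -> W = tofrac w ->
  tofrac H = 2%:R * X * Y ^+ 2 + 2%:R * X ^+ 2 + 2%:R * coefF t * X - 2%:R * coefF a1 * Y
    + Z ^+ 2 * W - 2%:R^-1 * W ^+ 2 + coefF a0 * Z + X * W + 2%:R * Y * Z * W.
Proof.
move=> -> -> -> ->; rewrite /H /HamH -mul_mpolyC.
rewrite !(rmorph_nat, rmorphXn, rmorphM, rmorphN, rmorphD) /=.
rewrite -[tofrac (_^-1)%:MP]/(coefF _) fmorphV rmorph_nat.
by [].
Qed.

Lemma ratfun_X_neq0 i : tofrac 'X_i != 0 :> ratfun F.
Proof. by rewrite tofrac_eq0 (mpolyX_neq0 F wgt). Qed.

Lemma ratfun_2_neq0 : 2%:R != 0 :> ratfun F.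
Proof. by rewrite -(rmorph_nat (@coefF F)) fmorph_eq0 char0. Qed.

Lemma mmap_X (r : 4.-tuple (ratfun F)) i : mmap (@coefF F) (tnth r) 'X_i = tnth r i.
Proof. by rewrite mmapX mmap1U. Qed.

Lemma mmap_C (r : 4.-tuple (ratfun F)) c : mmap (@coefF F) (tnth r) c%:MP = coefF c.
Proof. exact: mmapC. Qed.

Lemma coefF_half : coefF (2%:R^-1 : F) = 2%:R^-1.
Proof. by rewrite fmorphV rmorph_nat. Qed.

Lemma HamH_r0 : polynomial_in (r0 a0) H.
Proof.
exists (2%:R * x * y ^+ 2 + 2%:R * x ^+ 2 + 2%:R * t%:MP * x - 2%:R * a1%:MP * y - w
  - (2%:R^-1)%:MP * ((w * z + a0%:MP) * z) ^+ 2 - x * (w * z + a0%:MP) * z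
  - 2%:R * y * (w * z + a0%:MP)).
rewrite (tofrac_HamH erefl erefl erefl erefl) !(rmorph_nat, rmorphXn, rmorphM, rmorphN, rmorphD) /=.
rewrite !mmap_C !mmap_X coefF_half !(tnth_nth 0) /=.
exact: H_in_r0 ratfun_2_neq0 (ratfun_X_neq0 iz).
Qed.

Lemma HamH_r1 : polynomial_in (r1 a1) H.
Proof.
pose uy := - (x * y - a1%:MP); pose u := uy * y.
exists (- 2%:R * x + 2%:R * (u - z ^+ 2) ^+ 2 + 2%:R * t%:MP * (u - z ^+ 2)
  - (2%:R^-1)%:MP * w ^+ 2 + a0%:MP * z + u * w + 2%:R * z * uy).
rewrite /u /uy (tofrac_HamH erefl erefl erefl erefl) !(rmorph_nat, rmorphXn, rmorphM, rmorphN, rmorphD) /=.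
rewrite !mmap_C !mmap_X coefF_half !(tnth_nth 0) /=.
exact: H_in_r1 ratfun_2_neq0 (ratfun_X_neq0 iy).
Qed.

Lemma HamH_r2 : polynomial_in (r2 t a2) (H + eta *: y).
Proof.
pose v := - (x * y - a2%:MP) * y.
exists (2%:R * x + 2%:R * (v - w - t%:MP) * (v - w) + z ^+ 2 * w - (2%:R^-1)%:MP * w ^+ 2
  + a0%:MP * z + (v - w - t%:MP) * w).
rewrite /v /eta tofracD (tofrac_HamH erefl erefl erefl erefl) -mul_mpolyC.
rewrite !(rmorph_nat, rmorphXn, rmorphM, rmorphN, rmorphD) /=.
rewrite !mmap_C !mmap_X coefF_half !(tnth_nth 0) /=.
exact: H_in_r2 ratfun_2_neq0 (ratfun_X_neq0 iy).
Qed.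

End Solution.

(** * Uniqueness *)

Section Uniqueness.
Variable F : fieldType.
Hypothesis char0 : forall k, k.+1%:R != 0 :> F.

(** Counterpart of [sp_val] with coefficients in [F], for polynomials involving [t] and the
    parameters. *)
Definition fval (p : seq (F * exponent)) : {mpoly F[4]} :=
  \sum_(u <- p) u.1 *: 'X_[mon u.2].

Lemma mmeasure_fval (mf : measure 4) d p : all (fun u => mf (mon u.2) <= d)%N p ->
  (mmeasure mf (fval p) <= d.+1)%N.
Proof. by move=> /allP le_d; apply: mmeasure_sumX. Qed.

Lemma fval_nil : fval [::] = 0.
Proof. by rewrite /fval big_nil. Qed.

Lemma fval_cons u p : fval (u :: p) = u.1%:MP * 'X_[mon u.2] + fval p.
Proof. by rewrite /fval big_cons mul_mpolyC. Qed.

Definition fvalE := (fval_cons, fval_nil, mpolyX_mon).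

Lemma mdeg_mon e : size e = 4%N -> mdeg (mon e) = sumn e.
Proof.
case: e => [|i [|j [|k [|l []]]]] // _.
by rewrite mdegE !big_ord_recr big_ord0 !mnmE /= addn0 !addnA.
Qed.

(* The part of p that survives at y = z = w = 0. *)
Definition x_part (p : {mpoly F[4]}) : {poly F} :=
  mmap polyC (fun i => if i == ix then 'X else 0) p.

Lemma x_part_coef p k : (x_part p)`_k = p@_(mon (xyzw k 0 0 0)).
Proof.
rewrite [in LHS](mpolyE p) [in RHS](mpolyE p) /x_part !raddf_sum /= coef_sum.
apply: eq_bigr => m _; rewrite mmapZ mmapX coefCM mcoeffZ mcoeffX; congr (_ * _).
rewrite /mmap1 !big_ord_recr big_ord0 /= mul1r.
rewrite -[m]mon_exponents_of mon_eq /exponents_of !mnmE /exp_eq /=.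
rewrite !expr0n andbT; case: (m iy == 0%N); case: (m iz == 0%N); case: (m iw == 0%N);
  rewrite ?(mulr0, mul0r, coef0, andbF, mulr1, andbT, coefXn) //. by rewrite eq_sym.
Qed.

Variables t a0 a1 a2 : F.

Let y : {mpoly F[4]} := 'X_iy.
Let H := HamH t a0 a1.
Let eta := a0 + 2%:R * a1 + 2%:R * a2.

Lemma HamH_fval : H = fval
  [:: (2, xyzw 1 2 0 0); (2, xyzw 2 0 0 0); (2 * t, xyzw 1 0 0 0); (- 2 * a1, xyzw 0 1 0 0);
      (1, xyzw 0 0 2 1); (- 2^-1, xyzw 0 0 0 2); (a0, xyzw 0 0 1 0); (1, xyzw 1 0 0 1);
      (2, xyzw 0 1 1 1)].
Proof.
rewrite /H /HamH !fvalE /= -mul_mpolyC !(mpolyCM, mpolyCN, mpolyC_nat, mpolyC1).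
by ring.
Qed.

(** Doubling removes the coefficient 1/2, so that the leading form of 2 y H can be matched with the
    integral [defect 5]. *)
Lemma double_HamH : 2 * H = fval
  [:: (4, xyzw 1 2 0 0); (4, xyzw 2 0 0 0); (4 * t, xyzw 1 0 0 0); (- 4 * a1, xyzw 0 1 0 0);
      (2, xyzw 0 0 2 1); (- 1, xyzw 0 0 0 2); (2 * a0, xyzw 0 0 1 0); (2, xyzw 1 0 0 1);
      (4, xyzw 0 1 1 1)].
Proof.
have half : 2 * (2^-1)%:MP = 1 :> {mpoly F[4]}.
  by rewrite -mpolyC_nat -mpolyCM divff ?mpolyC1 ?(char0 1).
rewrite /H /HamH !fvalE /= -mul_mpolyC !(mpolyCM, mpolyCN, mpolyC_nat, mpolyC1).
apply/eqP; rewrite -subr_eq0; apply/eqP.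
by transitivity ((1 - 2 * (2^-1)%:MP) * 'X_iw ^+ 2 : {mpoly F[4]}); [ring | rewrite half; ring].
Qed.

Lemma msize_HamH : (msize H <= 4)%N.
Proof. by rewrite HamH_fval mmeasure_fval //= !mdeg_mon. Qed.

Lemma x_part_HamH : x_part H = 2 * 'X ^+ 2 + 2 * t%:P * 'X.
Proof.
rewrite /x_part /H /HamH -mul_mpolyC.
rewrite !(rmorph_nat, rmorphXn, rmorphM, rmorphN, rmorphD) /= !mmapC !mmapX !mmap1U /=.
ring.
Qed.

Lemma HamH_x2 : H@_(mon (xyzw 2 0 0 0)) = 2.
Proof.
rewrite -x_part_coef x_part_HamH -!polyC_natr -mulrA coefD !coefCM coefXn coefX.
by rewrite /= mulr1 mulr0 mulr0 addr0.
Qed.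

Lemma HamH_x4 : H@_(mon (xyzw 4 0 0 0)) = 0.
Proof.
rewrite -x_part_coef x_part_HamH -!polyC_natr -mulrA coefD !coefCM coefXn coefX.
by rewrite /= !mulr0 addr0.
Qed.

Lemma HamH_sq_x4 : (H ^+ 2)@_(mon (xyzw 4 0 0 0)) = 4.
Proof.
rewrite -x_part_coef /x_part rmorphXn /= -/(x_part H) x_part_HamH.
have -> : (2 * 'X ^+ 2 + 2 * t%:P * 'X) ^+ 2 =
    4%:P * 'X^4 + (8 * t)%:P * 'X^3 + (4 * t ^+ 2)%:P * 'X^2 :> {poly F}.
  by ring.
by rewrite !coefD !coefCM !coefXn /= mulr1 !mulr0 !addr0.
Qed.

Lemma wgt_le_mdeg (K : {mpoly F[4]}) d :
  (msize K <= d.+1)%N -> (mmeasure wgt K <= (2 * d).+1)%N.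
Proof.
move=> /mmeasure_leP Kd; apply/mmeasure_leP => m lt_m; apply: Kd.
by move: lt_m; rewrite /= mdeg_exponents_of /= /wgt; lia.
Qed.

Lemma condA2_uniqueness K : condA2 t a0 a1 a2 K -> (msize K <= 7)%N ->
  exists c1 c, K = c1 *: H + c%:MP /\ c1 * eta = 1.
Proof.
move=> [K_r0 K_r1 K_r2] K7.
(* H^2 has x^4-coefficient 4 and H has x^2-coefficient 2, so these choices remove x^4 and x^2 from
   [K']. [c1] comes second because H^2 may also contain x^2. *)
pose c2 := K@_(mon (xyzw 4 0 0 0)) / 4.
pose c1 := (K - c2 *: H ^+ 2)@_(mon (xyzw 2 0 0 0)) / 2.
pose K' := K - c1 *: H - c2 *: H ^+ 2.
pose e0 := 1 - c1 * eta; pose e1 := - (c2 * eta).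
(* Chosen so that [K' + B] is (K + y) - c1 (H + eta y) - c2 (H + eta y)^2, which is polynomial in
   r_2. *)
pose B := e0 *: y + e1 *: (2 * y * H + eta *: y ^+ 2).
have sz_K' : (msize K' <= 7)%N.
  have H2 : (msize (H ^+ 2) <= 7)%N.
    by have := mmeasureM_le mdeg H H; move: msize_HamH; rewrite expr2; lia.
  have le_sub p q : (msize p <= 7)%N -> (msize q <= 7)%N -> (msize (p - q) <= 7)%N.
    by move=> hp hq; rewrite (leq_trans (mmeasureD_le _ _ _)) // geq_max hp mmeasureN.
  by apply: (le_sub); first apply: (le_sub) => //; apply: leq_trans (mmeasureZ_le _ _ _) _;
    rewrite ?H2 // (leq_trans msize_HamH).
have K'2 : K'@_(mon (xyzw 2 0 0 0)) = 0.
  by rewrite /K' addrAC mcoeffB mcoeffZ HamH_x2 divfK ?subrr ?(char0 1).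
have K'4 : K'@_(mon (xyzw 4 0 0 0)) = 0.
  rewrite /K' !mcoeffB !mcoeffZ HamH_x4 HamH_sq_x4 mulr0 subr0.
  by rewrite divfK ?subrr ?(char0 3).
have K'_r r : polynomial_in r K -> polynomial_in r H -> polynomial_in r K'.
  move=> rK rH; rewrite /K' -!scaleNr.
  apply/polynomial_inD/polynomial_inZ/polynomial_inM => //.
  exact/polynomial_inD/polynomial_inZ.
have K'_r0 : polynomial_in (r0 a0) K' by apply: K'_r => //; apply: HamH_r0.
have K'_r1 : polynomial_in (r1 a1) K' by apply: K'_r => //; apply: HamH_r1.
have K'_r2 : polynomial_in (r2 t a2) (K' + B).
  have -> : K' + B = (K + y) + (- c1) *: (H + eta *: y) +
      (- c2) *: ((H + eta *: y) * (H + eta *: y)).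
    rewrite /K' /B /e0 /e1 -!mul_mpolyC.
    rewrite !(mpolyCD, mpolyCM, mpolyCN, mpolyC1); ring.
  have := HamH_r2 char0 t a0 a1 a2; rewrite -/H -/eta -/y => rH.
  by apply/polynomial_inD/polynomial_inZ/polynomial_inM => //;
    apply/polynomial_inD/polynomial_inZ.
(* The weight 5 part of [B] is split off; the rest has weight at most 3. *)
have BE : B = lincomb [:: e1] (defect 5) + fval [:: (4 * e1 * t, xyzw 1 1 0 0);
    (- 4 * e1 * a1 + e1 * eta, xyzw 0 2 0 0); (2 * e1 * a0, xyzw 0 1 1 0);
    (e0, xyzw 0 1 0 0)].
  rewrite /B /lincomb /= big_seq1 !sp_valE mulrAC double_HamH !fvalE /=.
  rewrite -!mul_mpolyC !(mpolyCD, mpolyCM, mpolyCN, mpolyC1, mpolyC_nat).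
  by rewrite /y; ring.
have B_le d : (6 <= d)%N -> (mmeasure wgt B <= d)%N.
  move=> le_d; apply: leq_trans le_d.
  rewrite BE (leq_trans (mmeasureD_le _ _ _)) // geq_max mmeasure_fval ?andbT.
    rewrite /lincomb /= big_seq1 (leq_trans (mmeasureZ_le _ _ _)) //.
    by apply: mmeasure_sp_val.
  by rewrite /= !wgt_mon.
have step d us : (0 < d <= 12)%N -> (mmeasure wgt K' <= d.+1)%N ->
    (mmeasure wgt B <= d.+1)%N -> size us = size (defect d) ->
    (mmeasure wgt (B - lincomb us (defect d)) <= d)%N ->
    (mmeasure wgt K' <= d)%N /\ all (pred1 0) us.
  by move=> d_bd Kd Bd sz Bus; apply: (descent_step char0) K'_r0 K'_r1 K'_r2.
have lincomb0 : lincomb [::] [::] = 0 :> {mpoly F[4]} by rewrite /lincomb big_nil.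
(* Weights 12 down to 6: [B] has weight at most 5, so there is no defect. *)
have K'_6 : (mmeasure wgt K' <= 6)%N.
  have high d : (6 <= d <= 12)%N -> (mmeasure wgt K' <= d.+1)%N -> (mmeasure wgt K' <= d)%N.
    case/andP=> ge6 le12 Kd; have d0 : defect d = [::].
      by rewrite /defect !gtn_eqF // (leq_trans _ ge6).
    have Bd := B_le d ge6.
    apply: (proj1 (step d [::] _ Kd (leqW Bd) _ _)); rewrite ?d0 ?lincomb0 ?subr0 //.
    by rewrite le12 (leq_trans _ ge6).
  do 7![apply: (high) => //]; exact: (wgt_le_mdeg (d := 6) sz_K').
have B_5 : (mmeasure wgt (B - lincomb [:: e1] (defect 5)) <= 5)%N.
  by rewrite BE addrC addKr (leq_trans (mmeasure_fval (d := 3) _)) //= !wgt_mon.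
(* Weight 5 also kills [e1], that is c2 eta = 0, which reduces [B] to [e0 *: y]. *)
have [K'_5] := step 5%N [:: e1] isT K'_6 (B_le 6%N isT) erefl B_5.
rewrite /= andbT => /eqP e1_0.
have {}BE : B = e0 *: y by rewrite /B e1_0 scale0r addr0.
have {}B_le : (mmeasure wgt B <= 2)%N.
  by rewrite BE (leq_trans (mmeasureZ_le _ _ _)) // mmeasureX /= /wgt !mnm1E.
have low d : (2 <= d <= 4)%N -> (mmeasure wgt K' <= d.+1)%N -> (mmeasure wgt K' <= d)%N.
  case/andP=> ge2 le4 Kd; have d0 : defect d = [::].
    by rewrite /defect ltn_eqF ?ltnS // gtn_eqF.
  have B_d : (mmeasure wgt B <= d)%N := leq_trans B_le ge2.
  apply: (proj1 (step d [::] _ Kd (leqW B_d) _ _)); rewrite ?d0 ?lincomb0 ?subr0 //.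
  by rewrite (leq_trans _ ge2) // (leq_trans le4).
have K'_2 : (mmeasure wgt K' <= 2)%N by do 3![apply: (low) => //].
have B_1 : (mmeasure wgt (B - lincomb [:: e0] (defect 1)) <= 1)%N.
  rewrite /lincomb /= big_seq1 BE !sp_valE /= !expr0 expr1 mul1r !mulr1 addr0 mulr1z.
  by rewrite subrr mmeasure0.
(* In weight 1 the defect is y itself, and [e0 = 0] reads c1 eta = 1. *)
have [K'_1] := step 1%N [:: e0] isT K'_2 B_le erefl B_1.
rewrite /= andbT subr_eq0 eq_sym => /eqP c1_eta.
have c2_0 : c2 = 0.
  apply/eqP; move/eqP: e1_0; rewrite /e1 oppr_eq0 mulf_eq0 => /orP[//|/eqP eta0].
  by move/eqP: c1_eta; rewrite eta0 mulr0 eq_sym oner_eq0.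
exists c1, (K'@_0%MM); split=> //.
have <- : K' = (K'@_0%MM)%:MP.
  apply/mpolyP => m; rewrite mcoeffC; have [->|m_neq0] := eqVneq m 0%MM.
    by rewrite mulr1.
  rewrite mulr0; move/mmeasure_leP: K'_1; apply; rewrite lt0n; apply: contra m_neq0.
  rewrite /= /wgt => /eqP wm; apply/eqP/mnmP.
  by elim/forall_ord4; rewrite mnm0E; move: wm; lia.
by rewrite /K' c2_0 scale0r subr0 addrC subrK.
Qed.

End Uniqueness.

(** * From the Hamiltonian to the system, and the relation on the parameters *)

Lemma hamiltonian_systemDC (F : fieldType) (G : {mpoly F[4]}) c :
  hamiltonian_system (G + c%:MP) = hamiltonian_system G.
Proof. by rewrite /hamiltonian_system !mderivD !mderivC !addr0. Qed.

(** The term 2 x^2 of H contributes 4 x to its x-derivative; comparing these coefficients gives 4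
    (c1 - 1) = 0. *)
Lemma mderiv_HamH_determines (F : fieldType) (t a0 a1 c1 c : F) (K : {mpoly F[4]}) :
  (forall k, k.+1%:R != 0 :> F) -> K = c1 *: HamH t a0 a1 + c%:MP ->
  hamiltonian_system K = hamiltonian_system (HamH t a0 a1) -> c1 = 1.
Proof.
move=> char0 -> /(congr1 (fun s => tnth s iy)); rewrite !(tnth_nth 0) /= => /oppr_inj.
rewrite mderivD mderivZ mderivC addr0 => /(congr1 (mcoeff U_(ix))).
rewrite mcoeffZ mcoeff_deriv.
have -> : (U_(ix) + U_(ix))%MM = mon (xyzw 2 0 0 0).
  by apply/mnmP; elim/forall_ord4; rewrite mnmDE !mnm1E mnmE.
rewrite HamH_x2 mnm1E eqxx => /eqP.
rewrite -subr_eq0 -[X in _ - X]mul1r -mulrBl mulf_eq0 subr_eq0 -mulrnA.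
by rewrite (negPf (char0 3)) orbF => /eqP.
Qed.

Lemma scal_inj (R : realType) : injective (@scal R).
Proof. by move=> a b /eqP; rewrite tofrac_eq => /eqP/polyC_inj. Qed.

Lemma Ct_char0 (R : realType) k : k.+1%:R != 0 :> Ct R.
Proof.
rewrite -(rmorph_nat (@tofrac {poly R[i]})) tofrac_eq0 -polyC_natr polyC_eq0.
by rewrite Num.Theory.pnatr_eq0.
Qed.

Theorem theorem2p4 (R : realType) (a0 a1 a2 : R[i]) (K : {mpoly (Ct R)[4]}) :
  condA2 (tvar R) (scal a0) (scal a1) (scal a2) K ->
  (* msize is the total degree plus one *)
  (msize K = 7%N ->
     a0 + 2%:R * a1 + 2%:R * a2 = 1
     /\ hamiltonian_system K = hamiltonian_system (HamH (tvar R) (scal a0) (scal a1)))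
  /\
  ((msize K <= 7)%N ->
     (a0 + 2%:R * a1 + 2%:R * a2 = 1
      <-> hamiltonian_system K
          = hamiltonian_system (HamH (tvar R) (scal a0) (scal a1)))).
Proof.
move=> condK; set H := HamH _ _ _.
have eta_eq1 : a0 + 2%:R * a1 + 2%:R * a2 = 1 <->
    scal a0 + 2%:R * scal a1 + 2%:R * scal a2 = 1.
  have <- : scal (a0 + 2%:R * a1 + 2%:R * a2) = scal a0 + 2%:R * scal a1 + 2%:R * scal a2.
    by rewrite /scal !(rmorph_nat, rmorphM, rmorphD).
  have scal1 : scal 1 = 1 :> Ct R by rewrite /scal !rmorph1.
  by split=> [-> //|]; rewrite -scal1 => /scal_inj.
have char0 := @Ct_char0 R.
split=> [K7|K7].
  (* As c1 H + c has degree at most 3, degree exactly 6 is contradictory. *)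
  have [c1 [c [KE _]]] := condA2_uniqueness char0 condK (eq_leq K7).
  have : (msize K <= 4)%N; last by rewrite K7.
  rewrite KE (leq_trans (mmeasureD_le _ _ _)) // geq_max mmeasureC.
  rewrite (leq_trans (mmeasureZ_le _ _ _)) ?msize_HamH //.
  by case: (c != 0).
(* Since c1 eta = 1, the relation eta = 1 amounts to c1 = 1, which is equivalent to equality of the
   two systems. *)
have [c1 [c [KE c1_eta]]] := condA2_uniqueness char0 condK K7.
rewrite eta_eq1; split=> [eta1 | sysK].
  move: c1_eta; rewrite eta1 mulr1 => c1E.
  by rewrite KE c1E scale1r hamiltonian_systemDC.
by move: c1_eta; rewrite (mderiv_HamH_determines char0 KE sysK) mul1r.
Qed.
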